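(* For $n\ge 1$ write $$F_{132,n}=\sum_{\sigma\in\mathcal{S}_n(132)} q^{\mathrm{maj}(\sigma)}t^{\mathrm{des}(\sigma)}=\sum_{i=0}^{n-1} t^i\, g_{132,n,i}(q).$$ For every $n\ge 3$, $g_{132,n,0}(q)=1$ and $$g_{132,n,1}(q)=\sum_{i=1}^{n-1}(n-i)q^i,$$ and $g_{132,n,1}$ is not symmetric. For every $n\ge 5$, $$g_{132,n,2}(q)=\binom{n-1}{2}q^3+\left(\binom{n-1}{2}-1\right)q^4+(n^2-4n+1)q^5+(\text{terms of degree at least } 6 \text{ in } q),$$ and $g_{132,n,2}$ is not unimodal.
   Context: $\mathcal{S}_n(132)$ is the set of permutations $\sigma=(\sigma_1,\dots,\sigma_n)$ of $\{1,\dots,n\}$ avoiding the pattern $132$, i.e. having no indices $a<b<c$ with $\sigma_a<\sigma_c<\sigma_b$. $\mathrm{Des}(\sigma)=\{j:\sigma_j>\sigma_{j+1}\}$, $\mathrm{des}(\sigma)=|\mathrm{Des}(\sigma)|$, $\mathrm{maj}(\sigma)=\sum_{j\in\mathrm{Des}(\sigma)}j$. A nonzero polynomial $f(q)=\sum_{k=a}^{N}b_kq^k$ with $b_a,b_N\ne0$ is symmetric if $f(q)=q^{N+a}f(q^{-1})$ (its coefficient sequence is palindromic), and unimodal if $b_a\le b_{a+1}\le\dots\le b_j\ge b_{j+1}\ge\dots\ge b_N$ for some $j$. *)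

(* Defs.v *)
From mathcomp Require Import all_boot all_order all_algebra perm.

Set Implicit Arguments.
Unset Strict Implicit.
Unset Printing Implicit Defensive.

Import GRing.Theory Num.Theory.
Local Open Scope ring_scope.

(* A permutation of {1, ..., n} is an element of {perm 'I_n}: both positions  *)
(* and values are shifted down by one.                                        *)
Definition avoids132 (n : nat) (s : {perm 'I_n}) : bool :=
  ~~ [exists a : 'I_n, exists b : 'I_n, exists c : 'I_n,
       [&& (a < b)%N, (b < c)%N, (s a < s c)%N & (s c < s b)%N]].

Definition S132 (n : nat) : {set {perm 'I_n}} := [set s | avoids132 s].

(* The descent at the 1-based position j compares the entries with 0-based    *)
(* indices j - 1 and j, so it is recorded by the 0-based index j. The values  *)
(* of the elements of Des s are thus the usual 1-based descent positions,     *)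
(* and maj needs no shift.                                                    *)
Definition Des (n : nat) (s : {perm 'I_n}) : {set 'I_n} :=
  [set j : 'I_n | [exists i : 'I_n, (i.+1 == j :> nat) && (s j < s i)%N]].

Definition des (n : nat) (s : {perm 'I_n}) : nat := #|Des s|.

Definition maj (n : nat) (s : {perm 'I_n}) : nat := (\sum_(j in Des s) j)%N.

(* Bivariate polynomials in q and t: the inner variable is q, the outer       *)
(* variable is t.                                                             *)
Definition F132 (n : nat) : {poly {poly int}} :=
  \sum_(s in S132 n) ('X^(maj s))%:P * 'X^(des s).

Definition g132 (n i : nat) : {poly int} := (F132 n)`_i.

(* The exponents a and N of the lowest and highest nonzero terms of f; both   *)
(* are 0 for f = 0, so that the zero polynomial satisfies the two predicates  *)
(* below, and their negations imply f != 0.                                   *)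
Definition lowdeg (f : {poly int}) : nat := find (fun c => c != 0) f.

Definition topdeg (f : {poly int}) : nat := (size f).-1.

(* f(q) = q^(N + a) f(q^-1), as an identity of rational functions in q.       *)
Definition symmetric_poly (f : {poly int}) : Prop :=
  tofrac f = tofrac 'X ^+ (topdeg f + lowdeg f)
             * (map_poly (fun c : int => tofrac c%:P) f).[(tofrac 'X)^-1].

Definition unimodal_poly (f : {poly int}) : Prop :=
  exists j : nat,
    [/\ (lowdeg f <= j <= topdeg f)%N,
        forall k : nat, (lowdeg f <= k < j)%N -> f`_k <= f`_k.+1
      & forall k : nat, (j <= k < topdeg f)%N -> f`_k.+1 <= f`_k].

(* Main.v *)
(* Idea. Encode s by its Lehmer code e_i = #{k > i : s_k < s_i}; this is a
   bijection onto the sequences with e_i < n - i (0-based i), being injective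
   between sets of n! elements. If s_i < s_{i+1}, then e_{i+1} - e_i counts the
   k > i+1 with s_i < s_k < s_{i+1}; if s_i > s_{i+1}, then e_i > e_{i+1}. Hence
   s avoids 132 iff e is weakly decreasing, and then the descents of s are the
   strict drops of e. The codes dropping exactly at j (1-based) are a^j 0^(n-j)
   with 1 <= a <= n - j, and those dropping exactly at i < j are given by pairs
   a > b >= 1 with a <= n - i and b <= n - j: there are C(n-i,2) - C(j-i,2) of
   them. The coefficients of q^3, q^4, q^5 in g_2 come from the descent sets
   {1,2}, {1,3} and {1,4}, {2,3}, and they form a strict valley. *)
Require Import Defs.
From mathcomp Require Import all_boot all_order all_algebra.
From mathcomp Require Import perm zify.

Set Implicit Arguments.
Unset Strict Implicit.
Unset Printing Implicit Defensive.

Import Order.TTheory GRing.Theory Num.Theory.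
Local Open Scope ring_scope.

(** * Lehmer codes and their bijection with permutations *)

Lemma card_ord_itv n a b : (b <= n)%N -> #|[set k : 'I_n | (a <= k < b)%N]| = (b - a)%N.
Proof.
move=> leb; rewrite -sum1dep_card -(big_mkord (fun k => (a <= k < b)%N) (fun=> 1%N)).
transitivity (\sum_(a <= k < b) 1)%N; last by rewrite sum_nat_const_nat muln1.
by rewrite (big_nat_widenl a 0) // (big_nat_widen 0 b n).
Qed.

Definition lehmer n (s : {perm 'I_n}) (i : 'I_n) : nat :=
  #|[set k : 'I_n | (i < k)%N && (s k < s i)%N]|.

Lemma lehmer_lt n (s : {perm 'I_n}) (i : 'I_n) : (lehmer s i < n - i)%N.
Proof.
have : (lehmer s i <= #|[set k : 'I_n | (i < k < n)%N]|)%N.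
  by apply/subset_leq_card/subsetP=> k; rewrite !inE ltn_ord andbT => /andP[].
rewrite card_ord_itv //; have := ltn_ord i; lia.
Qed.

Lemma lehmer_lt_ord n (s : {perm 'I_n}) (i : 'I_n) : (lehmer s i < n)%N.
Proof. exact: leq_trans (lehmer_lt s i) (leq_subr _ _). Qed.

(** Entries are taken in ['I_n] rather than [nat] so that codes form a finite type and can be
    counted. *)
Definition code n (s : {perm 'I_n}) : {ffun 'I_n -> 'I_n} :=
  [ffun i => Ordinal (lehmer_lt_ord s i)].

Lemma val_code n (s : {perm 'I_n}) i : code s i = lehmer s i :> nat.
Proof. by rewrite ffunE. Qed.

(* This recovers s i from lehmer s i and the entries before i, which is why the
   Lehmer code determines the permutation. *)
Lemma lehmer_before n (s : {perm 'I_n}) (i : 'I_n) :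
  (s i = lehmer s i + #|[set k : 'I_n | (k < i)%N && (s k < s i)%N]| :> nat)%N.
Proof.
transitivity #|[set k | (s k < s i)%N]|.
  rewrite -[LHS]subn0 -(card_ord_itv _ (ltnW (ltn_ord (s i)))).
  by rewrite -[LHS](card_preimset _ (@perm_inj _ s)); apply: eq_card => k; rewrite !inE.
rewrite -(cardsID [set k : 'I_n | (i < k)%N] [set k | (s k < s i)%N]).
congr (_ + _)%N; apply: eq_card => k; rewrite !inE 1?andbC //.
rewrite -leqNgt (leq_eqVlt k) andbC; have [->|ki] := eqVneq k i.
  by rewrite !ltnn ?andbF ?orbF.
by rewrite (inj_eq val_inj k i) (negbTE ki).
Qed.

(** Strong induction on the position. If the entries before [i] agree but [u i < v i], the earlier
    entries below [v i] and not below [u i] lie strictly between the two values, so there are at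
    most [v i - u i - 1] of them; equal codes would require at least [v i - u i]. Exchanging the two
    permutations gives equality. *)
Lemma code_inj n : injective (@code n).
Proof.
move=> s t eq_st.
have lst i : lehmer s i = lehmer t i by rewrite -!val_code eq_st.
have step (u v : {perm 'I_n}) (i : 'I_n) : (forall k, lehmer u k = lehmer v k) ->
    (forall k : 'I_n, (k < i)%N -> u k = v k) -> (v i <= u i)%N.
  move=> luv uv; rewrite leqNgt; apply/negP=> lt_uv.
  have := lehmer_before u i; have := lehmer_before v i.
  rewrite luv.
  set A := [set k : 'I_n | (k < i)%N && (v k < v i)%N]; set B := [set k | _ & _].
  have : (#|A :\: B| <= #|[set k : 'I_n | (u i < k < v i)%N]|)%N.
    rewrite -(card_imset _ (@perm_inj _ v)); apply/subset_leq_card/subsetP.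
    move=> _ /imsetP[k /[!inE] /andP[nB /andP[ki vk] ->]].
    rewrite vk andbT; move: nB; rewrite ki /= uv // -leqNgt leq_eqVlt.
    case/orP=> // /eqP/val_inj; rewrite -(uv _ ki) => /perm_inj eik.
    by rewrite eik ltnn in ki.
  rewrite card_ord_itv; last exact: ltnW.
  have := cardsID B A.
  have : (#|A :&: B| <= #|B|)%N by apply/subset_leq_card/subsetIr.
  lia.
apply/permP=> i; have [m] := ubnP (i : nat); elim: m i => // m IH i /ltnSE im.
have uv (k : 'I_n) : (k < i)%N -> s k = t k by move=> ki; apply/IH/(leq_trans ki).
apply/val_inj/eqP; rewrite eqn_leq; apply/andP; split; apply: step => // k ki.
by rewrite uv.
Qed.

Definition Lehmer_codes n : {set {ffun 'I_n -> 'I_n}} :=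
  [set c : {ffun 'I_n -> 'I_n} | [forall i : 'I_n, (c i < n - i)%N]].

(** The bounds on the entries are independent, so the count is the product of the [n - i]. *)
Lemma card_Lehmer_codes n : #|Lehmer_codes n| = n`!.
Proof.
have -> : #|Lehmer_codes n| = #|family (fun i : 'I_n => [set v : 'I_n | (0 <= v < n - i)%N])|.
  apply: eq_card => c; rewrite !inE; apply/forallP/familyP => /= h i;
  by have := h i; rewrite !inE.
rewrite card_family foldrE big_map big_enum /=.
transitivity (\prod_(i < n) (n - i))%N.
  apply: eq_bigr => i _; rewrite -[RHS]subn0 -(card_ord_itv 0 (leq_subr i n)).
  exact: eq_card.
elim: n => [|n IH]; first by rewrite big_ord0.
by rewrite big_ord_recl subn0 factS -IH.
Qed.

Lemma imset_code n : @code n @: [set: {perm 'I_n}] = Lehmer_codes n.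
Proof.
apply/eqP; rewrite eqEcard card_Lehmer_codes (card_imset _ (@code_inj n)).
rewrite cardsT card_Sn leqnn andbT; apply/subsetP=> _ /imsetP[s _ ->].
by rewrite inE; apply/forallP=> i; rewrite val_code lehmer_lt.
Qed.

(** * Avoidance of 132 and descents, read off the code *)

Definition weakly_decreasing n (c : {ffun 'I_n -> 'I_n}) : bool :=
  [forall i : 'I_n, forall j : 'I_n, (i.+1 == j)%N ==> (c j <= c i)%N].

Definition drops n (c : {ffun 'I_n -> 'I_n}) : {set 'I_n} :=
  [set j : 'I_n | [exists i : 'I_n, (i.+1 == j)%N && (c j < c i)%N]].

(** Whatever is counted at [j] is also counted at [i], and [j] itself is counted only at [i]. *)
Lemma lehmer_descent n (s : {perm 'I_n}) (i j : 'I_n) :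
  i.+1 = j -> (s j < s i)%N -> (lehmer s j < lehmer s i)%N.
Proof.
move=> ij sji; apply: proper_card; apply/properP; split.
  apply/subsetP=> k; rewrite !inE -ij => /andP[jk skj].
  by rewrite (ltnW jk) (ltn_trans skj).
by exists j; rewrite !inE -ij ?ltnSn ?ltnn //= ij.
Qed.

(** Split the positions counted at [j] by whether their value is below [s i]. Those below are
    exactly the positions counted at [i], since [j] is not counted there. *)
Lemma lehmer_ascent n (s : {perm 'I_n}) (i j : 'I_n) :
  i.+1 = j -> (s i < s j)%N ->
  lehmer s j = (lehmer s i + #|[set k : 'I_n | (j < k)%N && (s i < s k < s j)%N]|)%N.
Proof.
move=> ij sij; rewrite /lehmer -(cardsID [set k | (s k < s i)%N]).
congr (_ + _)%N; apply: eq_card => k; rewrite !inE.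
  rewrite -ij; case: (ltnP (s k) (s i)) => ski; rewrite ?andbF // !andbT.
  rewrite (ltn_trans ski sij) andbT (leq_eqVlt i.+1); case: eqP => //= ik1.
  have ekj : k = j by apply/val_inj; rewrite /= -ij.
  by move: ski; rewrite ekj ltnNge (ltnW sij).
rewrite -leqNgt (leq_eqVlt (s i)); case: (ltnP j k) => jk; rewrite ?andbF //=; congr (_ && _).
case: eqP => //= /val_inj/perm_inj eik; by move: jk; rewrite -eik -ij ltnNge leqnSn.
Qed.

Lemma avoids132P n (s : {perm 'I_n}) :
  reflect (forall a b c : 'I_n, (a < b)%N -> (b < c)%N -> (s a < s c)%N ->
             (s c < s b)%N -> False)
          (avoids132 s).
Proof.
apply: (iffP idP) => [av a b c ab bc sac scb|av].
  case/negP: av; apply/existsP; exists a; apply/existsP; exists b.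
  by apply/existsP; exists c; rewrite ab bc sac.
apply/negP=> /existsP[a /existsP[b /existsP[c /and4P[]]]]; exact: av.
Qed.

(** A position counted by the extra term of [lehmer_ascent] would complete [i], [j] to an occurrence
    of 132. *)
Lemma lehmer_avoids_ascent n (s : {perm 'I_n}) (i j : 'I_n) :
  avoids132 s -> i.+1 = j -> (s i < s j)%N -> lehmer s j = lehmer s i.
Proof.
move=> /avoids132P av ij sij; rewrite (lehmer_ascent ij sij).
rewrite [X in (_ + X)%N](_ : _ = 0%N) ?addn0 //; apply: eq_card0 => k; rewrite !inE.
apply/negP=> /andP[jk /andP[sik skj]]; apply: (av i j k) => //.
by rewrite -ij.
Qed.

Lemma perm_ltn_total n (s : {perm 'I_n}) (i j : 'I_n) :
  (i < j)%N -> (s i < s j)%N = false -> (s j < s i)%N.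
Proof.
move=> ij; rewrite ltnNge => /negbFE; rewrite leq_eqVlt => /orP[/eqP/val_inj/perm_inj e|//].
by rewrite e ltnn in ij.
Qed.

Lemma avoids132_code n (s : {perm 'I_n}) : avoids132 s = weakly_decreasing (code s).
Proof.
apply/idP/forallP => [av i|dec].
  apply/forallP=> j; apply/implyP=> /eqP ij; rewrite !val_code.
  have [sij|/negbTE sij] := boolP (s i < s j)%N.
    by rewrite (lehmer_avoids_ascent av ij sij).
  by apply/ltnW/lehmer_descent/(perm_ltn_total _ sij); rewrite // -ij.
(* An occurrence a < b < c of 132 with b - a minimal has b = a + 1. *)
apply/avoids132P => a b c ab; have [d] := ubnP (b - a)%N.
elim: d a b c ab => // d IH a b c ab dab bc sac scb.
have a1n : (a.+1 < n)%N by apply: leq_ltn_trans ab (ltn_ord b).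
pose a' := Ordinal a1n.
(* If [b = a + 1], then [c] is counted by the extra term of [lehmer_ascent], so the code increases
   from [a] to [b]. *)
have [ea'b|a'b] := eqVneq a' b.
  move/forallP: (dec a) => /(_ b); rewrite -ea'b eqxx /= !val_code ea'b.
  rewrite (lehmer_ascent (i := a)) ?(ltn_trans sac) //; last by rewrite -ea'b.
  rewrite -[X in (_ <= X)%N]addn0 leq_add2l leqNgt => /negP[].
  by apply/card_gt0P; exists c; rewrite inE bc sac.
have {}a'b : (a' < b)%N by rewrite ltn_neqAle a'b.
(* Otherwise [a + 1] yields a shorter gap: it replaces [a] if its value is below [s c], and replaces
   [b] if its value is above. *)
have [sa'c|/negbTE sa'c] := boolP (s a' < s c)%N.
  by apply: (IH a' b c) => //=; move: a'b dab => /=; lia.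
apply: (IH a a' c) => //=; first by move: a'b dab => /=; lia.
  exact: ltn_trans a'b bc.
exact: perm_ltn_total (ltn_trans a'b bc) sa'c.
Qed.

Lemma Des_code n (s : {perm 'I_n}) : avoids132 s -> Des s = drops (code s).
Proof.
move=> av; apply/setP=> j; rewrite !inE; apply: eq_existsb => i.
case: eqP => //= ij; rewrite !val_code.
have [sij|/negbTE sij] := boolP (s i < s j)%N.
  by rewrite (lehmer_avoids_ascent av ij sij) ltnn ltnNge (ltnW sij).
have sji : (s j < s i)%N by apply: perm_ltn_total sij; rewrite -ij.
by rewrite sji lehmer_descent.
Qed.

(** The count moves to codes: [imset_code] makes every weakly decreasing Lehmer code the code of an
    avoider. *)
Lemma card_S132_Des n (D : {set 'I_n}) :
  #|[set s in S132 n | Des s == D]| =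
  #|[set c in Lehmer_codes n | weakly_decreasing c && (drops c == D)]|.
Proof.
rewrite -(card_imset _ (@code_inj n)); apply: eq_card => c.
apply/imsetP/idP => [[s]|].
  rewrite !inE => /andP[av /eqP <-] ->; rewrite Des_code // eqxx -avoids132_code av !andbT.
  by apply/forallP=> i; rewrite val_code lehmer_lt.
rewrite inE -imset_code => /andP[/imsetP[s _ ->] /andP[dec /eqP <-]].
have av : avoids132 s by rewrite avoids132_code.
by exists s; rewrite // !inE av Des_code /=.
Qed.

(** * Counting weakly decreasing codes with at most two prescribed drops *)

Lemma weakly_decreasing_const n (c : {ffun 'I_n -> 'I_n}) (i j : 'I_n) :
  weakly_decreasing c -> (i <= j)%N ->
  (forall k : 'I_n, (i < k <= j)%N -> k \notin drops c) -> c i = c j.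
Proof.
move=> /forallP dec; have [d] := ubnP (j - i)%N.
elim: d j => // d IH j dij; rewrite leq_eqVlt => /orP[/eqP/val_inj -> //|ij nodrop].
have j1n : (j.-1 < n)%N by have := ltn_ord j; lia.
pose j' := Ordinal j1n.
have jj' : j'.+1 = j by rewrite /=; lia.
have -> : c i = c j'.
  apply: IH => [||k ik]; [rewrite /=; lia..|apply: nodrop; move: ik => /=; lia].
have := nodrop j; rewrite ij leqnn inE => /(_ isT) /existsPn /(_ j').
rewrite jj' eqxx /= -leqNgt => le1; apply/val_inj/eqP; rewrite eqn_leq le1.
by have /forallP/(_ j) := dec j'; rewrite jj' eqxx => /= ->.
Qed.

(** The bound at the last position is 1; this pins the final plateau of a weakly decreasing code to
    0. *)
Lemma Lehmer_codes_max n (c : {ffun 'I_n.+1 -> 'I_n.+1}) :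
  c \in Lehmer_codes n.+1 -> c ord_max = ord0.
Proof.
rewrite inE => /forallP/(_ ord_max) /=; rewrite subSnn ltnS leqn0 => /eqP h.
exact/val_inj.
Qed.

(** One family serves for zero, one and two drops: [i = 0] empties the first plateau, and
    [i = j = 0] leaves the zero code. *)
Definition step_code n (i j : nat) (a b : 'I_n.+1) : {ffun 'I_n.+1 -> 'I_n.+1} :=
  [ffun k : 'I_n.+1 => if (k < i)%N then a else if (k < j)%N then b else ord0].

Lemma step_code_val n i j (a b k : 'I_n.+1) :
  step_code i j a b k =
  (if (k < i)%N then a : nat else if (k < j)%N then b : nat else 0%N) :> nat.
Proof. by rewrite ffunE; case: ifP => // _; case: ifP. Qed.

(** On a plateau the bound is tightest at the last position, [i - 1] or [j - 1], which gives the
    limits on [a] and [b]. *)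
Lemma step_code_Lehmer n (i j : nat) (a b : 'I_n.+1) :
  (i <= j <= n)%N -> (b <= a)%N -> (a <= n.+1 - i)%N -> (b <= n.+1 - j)%N ->
  (step_code i j a b \in Lehmer_codes n.+1) && weakly_decreasing (step_code i j a b).
Proof.
move=> ijn ba ain bjn; rewrite inE; apply/andP; split; apply/forallP => k.
  rewrite step_code_val; have := ltn_ord k; case: (ltnP k i); case: (ltnP k j); lia.
apply/forallP=> l; apply/implyP=> /eqP kl; rewrite !step_code_val.
case: (ltnP l i); case: (ltnP k i); case: (ltnP l j); case: (ltnP k j); lia.
Qed.

(** The conditionals cover [i = j], where the middle plateau is empty and the code falls from [a]
    straight to 0. *)
Lemma step_code_drops n (i j : nat) (a b k : 'I_n.+1) :
  (i <= j)%N -> (b <= a)%N ->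
  (k \in drops (step_code i j a b)) =
  (0 < k)%N && ((k == i :> nat) && ((if i < j then b : nat else 0) < a)%N
               || (k == j :> nat) && (0 < if i < j then b : nat else a)%N).
Proof.
move=> ij ba; rewrite inE; apply/existsP/idP => [[l]|].
  rewrite !step_code_val => /andP[/eqP lk].
  case: (ltnP k i); case: (ltnP l i); case: (ltnP k j); case: (ltnP l j); case: (ltnP i j); lia.
move=> h; have k1n : (k.-1 < n.+1)%N by have := ltn_ord k; lia.
exists (Ordinal k1n); rewrite !step_code_val /=; move: h.
case: (ltnP k i); case: (ltnP k.-1 i); case: (ltnP k j); case: (ltnP k.-1 j); case: (ltnP i j); lia.
Qed.

Lemma card_drops0 n :
  #|[set c in Lehmer_codes n.+1 | weakly_decreasing c && (drops c == set0)]| = 1%N.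
Proof.
have -> : [set c in Lehmer_codes n.+1 | weakly_decreasing c && (drops c == set0)] =
          [set step_code 0 0 ord0 ord0].
  apply/setP=> c; rewrite in_set1 inE; apply/idP/eqP => [/and3P[Lc dec /eqP D0]|->].
    apply/ffunP=> k; rewrite ffunE /= -(Lehmer_codes_max Lc).
    by apply: weakly_decreasing_const => // [|l _]; rewrite ?leq_ord ?D0 ?inE.
  rewrite andbA step_code_Lehmer //=; apply/eqP/setP=> k.
  by rewrite step_code_drops // inE /= !andbF.
exact: cards1.
Qed.

Lemma card_drops1 n (j : 'I_n.+1) : (0 < j)%N ->
  #|[set c in Lehmer_codes n.+1 | weakly_decreasing c && (drops c == [set j])]|
  = (n.+1 - j)%N.
Proof.
move=> j0.
have -> : [set c in Lehmer_codes n.+1 | weakly_decreasing c && (drops c == [set j])] =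
    (* The first plateau is empty here; giving it the value [b] as well meets the order hypothesis
       on the two values. *)
    (fun b => step_code 0 j b b) @: [set b : 'I_n.+1 | (1 <= b < (n.+1 - j).+1)%N].
  apply/setP=> c; apply/idP/imsetP => [|[b + ->]]; last first.
    rewrite [b \in _]inE => hb.
    rewrite inE andbA step_code_Lehmer ?leq_ord //=; [|lia..].
    apply/eqP/setP=> k; rewrite step_code_drops // inE j0 -(inj_eq val_inj) /=; lia.
  rewrite inE => /and3P[Lc dec /eqP Dj].
  have inD k : (k \in drops c) = (k == j :> nat) by rewrite Dj inE.
  have c0 (k : 'I_n.+1) : (k < j)%N -> c ord0 = c k.
    move=> kj; apply: weakly_decreasing_const => // l lk; rewrite inD; lia.
  have c1 (k : 'I_n.+1) : (j <= k)%N -> c k = ord0.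
    move=> kj; rewrite -(Lehmer_codes_max Lc).
    apply: weakly_decreasing_const; rewrite ?leq_ord // => l lk; rewrite inD; lia.
  exists (c ord0); last first.
    by apply/ffunP=> k; rewrite ffunE /=; case: ltnP => [/c0|/c1].
  rewrite inE; have : j \in drops c by rewrite inD.
  rewrite inE => /existsP[l /andP[/eqP lj]]; have lt_lj : (l < j)%N by rewrite -lj.
  rewrite -(c0 l) // (c1 j) // => /= ->; rewrite (c0 l) //.
  move: Lc; rewrite inE => /forallP/(_ l) /= h; apply: leq_trans h _; lia.
rewrite card_in_imset ?card_ord_itv; [lia|lia|].
move=> a b _ _ /ffunP/(_ ord0); rewrite !ffunE /= j0 //.
Qed.

(** Count the pairs b < a in {1, ..., m} by b: each b <= p leaves m - b choices of a, and the pairs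
    with b > p number C(m - p, 2). *)
Lemma sum_sub_bin2 m p : (p <= m)%N ->
  (\sum_(1 <= b < p.+1) (m - b) + 'C(m - p, 2) = 'C(m, 2))%N.
Proof.
elim: p => [|p IH] pm; first by rewrite big_geq // subn0.
rewrite big_nat_recr //= -IH; last exact: ltnW.
by rewrite -(subnSK pm) binS bin1 -addnA [('C(_, 2) + _)%N]addnC.
Qed.

(** Among the pairs in {1, ..., n + 1 - i}, those excluded have both entries above n + 1 - j, hence
    lie in a set of j - i elements. *)
Lemma card_pairs n i j : (0 < i < j)%N -> (j <= n)%N ->
  (#|[set p : 'I_n.+1 * 'I_n.+1 |
      (0 < p.2 < p.1)%N && ((p.1 <= n.+1 - i)%N && (p.2 <= n.+1 - j)%N)]|
   + 'C(j - i, 2) = 'C(n.+1 - i, 2))%N.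
Proof.
move=> ij jn.
have -> : (j - i = (n.+1 - i) - (n.+1 - j))%N by lia.
rewrite -(sum_sub_bin2 (m := n.+1 - i) (p := n.+1 - j)); last by lia.
congr (_ + _)%N; rewrite -sum1dep_card.
rewrite (eq_bigl (fun p : 'I_n.+1 * 'I_n.+1 =>
   (1 <= p.2 < (n.+1 - j).+1)%N && (p.2.+1 <= p.1 < (n.+1 - i).+1)%N)); last by move=> p /=; lia.
transitivity (\sum_(b < n.+1 | (1 <= b < (n.+1 - j).+1)%N)
                \sum_(a < n.+1 | (b.+1 <= a < (n.+1 - i).+1)%N) 1)%N.
  (* The coordinates are swapped because the outer sum runs over the smaller entry. *)
  rewrite pair_big_dep /= (reindex (fun p : 'I_n.+1 * 'I_n.+1 => (p.2, p.1))) //=.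
  by exists (fun p => (p.2, p.1)) => [[]|[]].
rewrite (big_nat_widenl 1 0) // (big_nat_widen 0 _ n.+1); last by lia.
rewrite big_mkord; apply: eq_big => [b|b _]; first by lia.
rewrite sum1dep_card card_ord_itv; lia.
Qed.

Lemma card_drops2 n (i j : 'I_n.+1) : (0 < i < j)%N ->
  (#|[set c in Lehmer_codes n.+1 | weakly_decreasing c && (drops c == [set i; j])]|
   + 'C(j - i, 2) = 'C(n.+1 - i, 2))%N.
Proof.
move=> ij; have jn := leq_ord j; rewrite -(card_pairs ij jn); congr (_ + _)%N.
have -> : [set c in Lehmer_codes n.+1 | weakly_decreasing c && (drops c == [set i; j])] =
    (fun p : 'I_n.+1 * 'I_n.+1 => step_code i j p.1 p.2) @: [set p : 'I_n.+1 * 'I_n.+1 |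
      (0 < p.2 < p.1)%N && ((p.1 <= n.+1 - i)%N && (p.2 <= n.+1 - j)%N)].
  apply/setP=> c; apply/idP/imsetP => [|[[a b] + ->]]; last first.
    rewrite [_ \in _]inE /= => hb.
    rewrite inE andbA step_code_Lehmer //=; [|lia..].
    apply/eqP/setP=> k; rewrite step_code_drops; [|lia..].
    rewrite !inE -(inj_eq val_inj k i) -(inj_eq val_inj k j) /=.
    case: (ltnP i j); lia.
  rewrite inE => /and3P[Lc dec /eqP Dj].
  have inD k : (k \in drops c) = (k == i :> nat) || (k == j :> nat) by rewrite Dj !inE.
  have c0 (k : 'I_n.+1) : (k < i)%N -> c ord0 = c k.
    move=> ki; apply: weakly_decreasing_const => // l lk; rewrite inD; lia.
  have c1 (k : 'I_n.+1) : (i <= k < j)%N -> c i = c k.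
    move=> kj; apply: weakly_decreasing_const => [//||l lk]; rewrite ?inD; lia.
  have c2 (k : 'I_n.+1) : (j <= k)%N -> c k = ord0.
    move=> kj; rewrite -(Lehmer_codes_max Lc).
    apply: weakly_decreasing_const; rewrite ?leq_ord // => l lk; rewrite inD; lia.
  exists (c ord0, c i); last first.
    apply/ffunP=> k; rewrite ffunE /=; case: ltnP => [/c0 //|ik].
    by case: ltnP => [kj|/c2 //]; rewrite (c1 k) ?ik.
  (* The two drops give [c i < c ord0] and [0 < c i]; the upper limits come from the code bounds at
     [k = i - 1] and [l = j - 1]. *)
  have : i \in drops c by rewrite inD eqxx.
  rewrite [i \in _]inE => /existsP[k /andP[/eqP ki]]; have lt_ki : (k < i)%N by rewrite -ki.
  rewrite -(c0 k) // => ci.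
  have : j \in drops c by rewrite inD eqxx orbT.
  rewrite [j \in _]inE => /existsP[l /andP[/eqP lj]]; have kl : (i <= l < j)%N by lia.
  rewrite (c2 j) // -(c1 l) // => cj; rewrite inE /= ci cj /=.
  move: Lc; rewrite inE => /forallP Lc.
  have := Lc k; have := Lc l; rewrite -(c0 k) // -(c1 l) //.
  move: (nat_of_ord (c i)) (nat_of_ord (c ord0)) => u v; lia.
rewrite card_in_imset //.
(* The values at positions 0 and [i] recover the pair, since [0 < i < j]. *)
move=> [a b] [a' b'] _ _ /ffunP E; have := E ord0; have := E i; rewrite !ffunE /= ltnn.
by case/andP: ij => -> -> -> ->.
Qed.

(** * Obstructions to symmetry and unimodality *)

(** With [d = topdeg f + lowdeg f], symmetry reads f = sum of f_i q^(d - i); the exponent [lowdeg f]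
    is reached only at [i = topdeg f]. *)
Lemma symmetric_lead_coef (f : {poly int}) :
  symmetric_poly f -> lead_coef f = f`_(lowdeg f).
Proof.
have [->|f0] := eqVneq f 0; first by rewrite lead_coef0 coef0.
have sz : (size f = (topdeg f).+1)%N by rewrite prednK // size_poly_gt0.
pose d := (topdeg f + lowdeg f)%N.
rewrite /symmetric_poly -/d (horner_coef_wide _ (size_poly _ _)) mulr_sumr.
have X0 : (tofrac 'X : {fraction {poly int}}) != 0 by rewrite tofrac_eq0 polyX_eq0.
(* All [i] in range are at most [d], so no negative power of q remains and the identity descends to
   polynomials by injectivity of [tofrac]. *)
rewrite (_ : \sum_(i < _) _ = tofrac (\sum_(i < size f) f`_i *: 'X^(d - i))); last first.
  rewrite rmorph_sum; apply: eq_bigr => i _.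
  have id : (i <= d)%N by apply: leq_trans (leq_addr _ _); rewrite -ltnS -sz ltn_ord.
  rewrite coef_poly ltn_ord -mul_polyC rmorphM /= mulrCA; congr (_ * _).
  by rewrite rmorphXn /= -[in LHS](subnK id) exprD -mulrA -exprMn divff // expr1n mulr1.
move/eqP; rewrite tofrac_eq => /eqP E; rewrite {2}E coef_sum sz big_ord_recr /=.
rewrite big1 ?add0r => [|i _]; last first.
  rewrite coefZ coefXn (_ : _ == _ = false) ?mulr0 //; have := ltn_ord i; lia.
by rewrite coefZ coefXn (_ : (d - _)%N = lowdeg f) ?eqxx ?mulr1 // /d; lia.
Qed.

Lemma lowdeg_le (f : {poly int}) k : f`_k != 0 -> (lowdeg f <= k)%N.
Proof.
move=> fk; rewrite leqNgt; apply/negP => lt_k.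
by have := before_find 0 lt_k; rewrite fk.
Qed.

Lemma topdeg_ge (f : {poly int}) k : f`_k != 0 -> (k <= topdeg f)%N.
Proof.
move=> fk; rewrite /topdeg; have : (k < size f)%N; last by lia.
by rewrite ltnNge; apply: contra fk => /leq_sizeP/(_ k (leqnn k)) ->.
Qed.

(** The nonzero outer coefficients place [k] and [k.+2] within the support range. A peak at most [k]
    contradicts the rise after [k.+1], a later one the fall after [k]. *)
Lemma valley_not_unimodal (f : {poly int}) k :
  0 < f`_k -> f`_k.+1 < f`_k -> f`_k.+1 < f`_k.+2 -> 0 < f`_k.+2 -> ~ unimodal_poly f.
Proof.
move=> fk lt1 lt2 fk2 [j [_ up down]].
have lk := lowdeg_le (lt0r_neq0 fk); have kt := topdeg_ge (lt0r_neq0 fk2).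
have [jk|kj] := leqP j k.
  by have := down k.+1; rewrite (leq_trans jk) // kt leNgt lt2 => /(_ isT).
by have := up k; rewrite lk kj leNgt lt1 => /(_ isT).
Qed.

(** * Coefficients of the generating function; zero and one descent *)

Lemma coef_g132 n i k :
  (g132 n i)`_k = #|[set s in S132 n | (des s == i) && (maj s == k)]|%:R.
Proof.
rewrite /g132 /F132 coef_sum coef_sum -sum1_card natr_sum.
under [RHS]eq_bigl do rewrite inE.
rewrite [RHS]big_mkcondr; apply: eq_bigr => s _; rewrite coefCM coefXn.
rewrite eq_sym; case: eqP => _; last by rewrite mulr0 coef0.
by rewrite mulr1 coefXn eq_sym; case: eqP.
Qed.

Lemma Des_gt0 n (s : {perm 'I_n}) j : j \in Des s -> (0 < j)%N.
Proof. by rewrite inE => /existsP[i /andP[/eqP <-]]. Qed.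

(** Index 0 is never a descent, having no predecessor. *)
Lemma des_lt n (s : {perm 'I_n.+1}) : (des s < n.+1)%N.
Proof.
rewrite /des -[X in (_ < X)%N]card_ord; apply: proper_card; apply/properP; split.
  exact/subsetP.
by exists ord0 => //; apply/negP => /Des_gt0.
Qed.

Lemma F132_expansion n : (1 <= n)%N -> F132 n = \sum_(i < n) 'X^i * (g132 n i)%:P.
Proof.
case: n => // n _; apply/polyP=> k; rewrite [RHS]coef_sum.
have [kn|nk] := ltnP k n.+1.
  rewrite (bigD1 (Ordinal kn)) //= coefMC coefXn eqxx mul1r big1 ?addr0 // => i ik.
  rewrite coefMC coefXn (_ : _ == _ = false) ?mul0r //.
  by apply: contraNF ik => /eqP ki; apply/eqP/val_inj.
rewrite big1 => [|i _]; last first.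
  rewrite coefMC coefXn (_ : _ == _ = false) ?mul0r //; have := ltn_ord i; lia.
rewrite coef_sum big1 // => s _; rewrite coefCM coefXn.
rewrite (_ : _ == _ = false) ?mulr0 //; have := des_lt s; lia.
Qed.

Lemma des_eq1 n (s : {perm 'I_n}) (j : 'I_n) :
  (des s == 1%N) && (maj s == j) = (Des s == [set j]).
Proof.
apply/andP/eqP => [[/cards1P[k Dk]]|Dj]; last by rewrite /des /maj Dj cards1 big_set1.
by rewrite /maj Dk big_set1 => /eqP/val_inj ->.
Qed.

Lemma des_eq2 n (s : {perm 'I_n}) :
  des s = 2%N -> exists i j : 'I_n, [/\ (0 < i < j)%N, Des s = [set i; j] & (maj s = i + j)%N].
Proof.
move=> /eqP/cards2P[i [j [ij Dij]]].
have majE : (maj s = i + j)%N by rewrite /maj Dij big_setU1 ?inE //= big_set1.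
have i0 : (0 < i)%N by apply: (@Des_gt0 _ s); rewrite Dij set21.
have j0 : (0 < j)%N by apply: (@Des_gt0 _ s); rewrite Dij set22.
have [lt_ij|lt_ji|/val_inj eij] := ltngtP i j.
- by exists i, j; rewrite i0.
- by exists j, i; rewrite j0 setUC addnC.
- by rewrite eij eqxx in ij.
Qed.

Lemma des_Des2 n (s : {perm 'I_n}) (i j : 'I_n) :
  i != j -> Des s = [set i; j] -> des s = 2%N /\ (maj s = i + j)%N.
Proof. by move=> ij D; rewrite /des /maj D cards2 ij big_setU1 ?inE //= big_set1. Qed.

Lemma g132_0 n : g132 n.+1 0 = 1.
Proof.
apply/polyP=> k; rewrite coef_g132 coef1; congr (_%:R).
case: k => [|k] /=.
  rewrite -(card_drops0 n) -card_S132_Des; apply: eq_card => s; rewrite !inE.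
  congr (_ && _); rewrite /des cards_eq0; case: eqP => //= D0.
  by rewrite /maj D0 big_set0.
apply: eq_card0 => s; rewrite inE /des cards_eq0; apply/negP=> /and3P[_ /eqP D0].
by rewrite /maj D0 big_set0.
Qed.

(** A single descent sits at position [maj s], so the coefficient at [k] counts the codes dropping
    exactly at [k]. *)
Lemma coef_g132_1 n k : (g132 n.+1 1)`_k = if (0 < k < n.+1)%N then (n.+1 - k)%:R else 0.
Proof.
rewrite coef_g132; case: ifP => [/andP[k0 kn]|kn].
  rewrite -(card_drops1 (j := Ordinal kn)) // -card_S132_Des; congr (_%:R).
  by apply: eq_card => s; rewrite !inE -(des_eq1 _ (Ordinal kn)).
rewrite eq_card0 // => s; rewrite inE; apply/negP=> /and3P[_ /cards1P[j Dj]].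
have := ltn_ord j; have : (0 < j)%N by apply: (@Des_gt0 _ s); rewrite Dj set11.
by rewrite /maj Dj big_set1 => j0 jn /eqP jk; rewrite -jk j0 jn in kn.
Qed.

Lemma g132_1 n : g132 n.+1 1 = \sum_(1 <= i < n.+1) (n.+1%:Z - i%:Z) *: 'X^i.
Proof.
apply/polyP=> k; rewrite coef_g132_1 coef_sum.
under eq_bigr do rewrite coefZ coefXn eq_sym.
case: ifP => [k1n|kn].
  rewrite (bigD1_seq k) ?iota_uniq ?mem_index_iota //= eqxx mulr1 big1 ?addr0.
    by rewrite natz subzn //; case/andP: k1n => _ /ltnW.
  by move=> i /negbTE ->; rewrite mulr0.
rewrite big_nat_cond big1 // => i /andP[i1n _].
by case: eqP => [ik|]; rewrite ?mulr0 // -ik i1n in kn *.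
Qed.

(** The extreme coefficients, at q and q^(n-1), are n - 1 and 1, which differ for n >= 3. *)
Lemma g132_1_not_symmetric n : (3 <= n)%N -> ~ symmetric_poly (g132 n 1).
Proof.
case: n => // n n2 /symmetric_lead_coef.
have c n1 : (0 < n1 < n.+1)%N -> (g132 n.+1 1)`_n1 != 0.
  by move=> h; rewrite coef_g132_1 h pnatr_eq0; lia.
have -> : lowdeg (g132 n.+1 1) = 1%N.
  apply/eqP; rewrite eqn_leq lowdeg_le ?c //=; last by lia.
  have : g132 n.+1 1 != 0 by apply: contraNneq (c 1%N _) => [->|]; rewrite ?coef0; lia.
  (* A lowest exponent 0 would make the constant coefficient nonzero, but it vanishes. *)
  rewrite /lowdeg lt0n; apply: contraNneq => h.
  have : has (fun c : int => c != 0) (g132 n.+1 1).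
    apply/(has_nthP 0); exists 1%N; last by apply: c; lia.
    by rewrite ltnNge; apply: contra (c 1%N _) => [/leq_sizeP->|] //; lia.
  by move/(nth_find 0); rewrite h coef_g132_1.
have -> : lead_coef (g132 n.+1 1) = (g132 n.+1 1)`_n.
  rewrite /lead_coef (_ : (size _) = n.+1) //; apply/eqP; rewrite eqn_leq.
  apply/andP; split; last by rewrite ltnNge; apply: contra (c n _) => [/leq_sizeP->|]; lia.
  by apply/leq_sizeP=> k nk; rewrite coef_g132_1 [(k < n.+1)%N]ltnNge nk andbF.
rewrite !coef_g132_1 !ifT; lia.
Qed.

(** * Two descents: the coefficients of q^3, q^4 and q^5 *)

Lemma card_S132_Des2 n (i j : 'I_n.+1) : (0 < i < j)%N ->
  (#|[set s in S132 n.+1 | Des s == [set i; j]]| + 'C(j - i, 2) = 'C(n.+1 - i, 2))%N.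
Proof. by move=> ij; rewrite card_S132_Des card_drops2. Qed.

Lemma coef_g132_2_lt3 n k : (k < 3)%N -> (g132 n 2)`_k = 0.
Proof.
move=> k3; rewrite coef_g132 eq_card0 // => s; rewrite inE; apply/negP.
by case/and3P=> _ /eqP/des_eq2[i [j [ij _ ->]]] /eqP; lia.
Qed.

(** Meant for 3 = 1 + 2 and 4 = 1 + 3, where the major index determines the descent set. *)
Lemma coef_g132_2_Des2 n (i j : 'I_n.+1) : (0 < i < j)%N ->
  (forall i' j' : 'I_n.+1, (0 < i' < j')%N -> (i' + j' = i + j)%N -> i' = i /\ j' = j) ->
  (g132 n.+1 2)`_(i + j) = #|[set s in S132 n.+1 | Des s == [set i; j]]|%:R.
Proof.
move=> ij uniq_ij; rewrite coef_g132; congr (_%:R); apply: eq_card => s; rewrite !inE.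
congr (_ && _); apply/andP/eqP => [[/eqP/des_eq2[i' [j' [ij' -> ->]]] /eqP]|D].
  by case/(uniq_ij _ _ ij') => -> ->.
by have [|-> ->] := des_Des2 _ D; rewrite // neq_ltn; case/andP: ij => _ ->.
Qed.

Lemma coef_g132_2_3 n : (3 <= n)%N -> (g132 n 2)`_3 = 'C(n.-1, 2)%:R.
Proof.
case: n => // n n2; have l1 : (1 < n.+1)%N by lia. have l2 : (2 < n.+1)%N by lia.
rewrite (@coef_g132_2_Des2 n (Ordinal l1) (Ordinal l2)) //=.
  have := card_S132_Des2 (i := Ordinal l1) (j := Ordinal l2) isT.
  by rewrite [(n.+1 - _)%N]subn1 => <-; rewrite addn0.
by move=> i j ij e; split; apply/val_inj; move: e => /=; lia.
Qed.

(** The added 1 is the correction C(3 - 1, 2). *)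
Lemma coef_g132_2_4 n : (4 <= n)%N -> (g132 n 2)`_4 + 1 = 'C(n.-1, 2)%:R.
Proof.
case: n => // n n2; have l1 : (1 < n.+1)%N by lia. have l3 : (3 < n.+1)%N by lia.
rewrite (@coef_g132_2_Des2 n (Ordinal l1) (Ordinal l3)) //=.
  have := card_S132_Des2 (i := Ordinal l1) (j := Ordinal l3) isT.
  by rewrite [(n.+1 - _)%N]subn1 => <-; rewrite natrD.
by move=> i j ij e; split; apply/val_inj; move: e => /=; lia.
Qed.

(** The descent sets {1,4} and {2,3} carry the corrections C(3, 2) = 3 and C(1, 2) = 0. *)
Lemma coef_g132_2_5_bin n : (5 <= n)%N ->
  (g132 n 2)`_5 + 3 = 'C(n.-1, 2)%:R + 'C(n.-2, 2)%:R.
Proof.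
case: n => // n n2; have l1 : (1 < n.+1)%N by lia. have l4 : (4 < n.+1)%N by lia.
have l2 : (2 < n.+1)%N by lia. have l3 : (3 < n.+1)%N by lia.
have := card_S132_Des2 (i := Ordinal l1) (j := Ordinal l4) isT.
have := card_S132_Des2 (i := Ordinal l2) (j := Ordinal l3) isT.
rewrite [(n.+1 - Ordinal l1)%N]subn1 [(n.+1 - Ordinal l2)%N]subn2 => <- <-.
set B := [set _ in _ | _]; set C := [set _ in _ | _].
have BC0 : B :&: C = set0.
  (* Position 1 belongs to only one of the two descent sets. *)
  apply/setP=> s; rewrite !inE; apply/negP=> /andP[/andP[_ /eqP->]] /andP[_ /eqP/setP].
  by move/(_ (Ordinal l1)); rewrite !inE.
rewrite coef_g132 (_ : [set s in _ | _] = B :|: C).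
  by rewrite cardsU BC0 cards0 subn0 addn0 !natrD addrAC.
apply/setP=> s; rewrite !inE -andb_orr; congr (_ && _); apply/andP/orP.
  case=> /eqP/des_eq2[i [j [ij -> ->]]] /eqP e5.
  have [i1|i1] := eqVneq (i : nat) 1%N; [left|right]; apply/eqP; congr [set _; _];
    apply/val_inj => /=; lia.
by case=> /eqP D; have [|-> ->] := des_Des2 _ D.
Qed.

(** Consecutive triangular numbers add up to a square; at m = n - 2 this makes the coefficient of
    q^5 equal to (n - 2)^2 - 3. *)
Lemma sqr_bin2 m : ('C(m.+1, 2) + 'C(m, 2) = m ^ 2)%N.
Proof. by elim: m => // m; rewrite !binS !bin1 bin0; lia. Qed.

Lemma coef_g132_2_5 n : (5 <= n)%N -> (g132 n 2)`_5 = n%:Z ^+ 2 - 4 * n%:Z + 1.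
Proof.
case: n => [|[|n]] // n2; apply: (addIr 3); rewrite coef_g132_2_5_bin //= -natrD sqr_bin2.
lia.
Qed.

Theorem theorem4 :
  [/\ forall n : nat, (1 <= n)%N ->
        F132 n = \sum_(i < n) 'X^i * (g132 n i)%:P,
      forall n : nat, (3 <= n)%N ->
        [/\ g132 n 0 = 1,
            g132 n 1 = \sum_(1 <= i < n) (n%:Z - i%:Z) *: 'X^i
          & ~ symmetric_poly (g132 n 1)]
    & forall n : nat, (5 <= n)%N ->
        (exists r : {poly int},
           g132 n 2 = ('C(n.-1, 2))%:Z *: 'X^3
                      + (('C(n.-1, 2))%:Z - 1) *: 'X^4
                      + (n%:Z ^+ 2 - 4 * n%:Z + 1) *: 'X^5
                      + r * 'X^6)
        /\ ~ unimodal_poly (g132 n 2)].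
Proof.
split; first exact: F132_expansion.
  case=> // n n3; split; [exact: g132_0|exact: g132_1|exact: g132_1_not_symmetric].
move=> n n5.
have c3 : (g132 n 2)`_3 = 'C(n.-1, 2)%:Z by rewrite coef_g132_2_3 ?natz //; lia.
have c4 : (g132 n 2)`_4 = 'C(n.-1, 2)%:Z - 1.
  by apply: (addIr 1); rewrite coef_g132_2_4 ?subrK ?natz //; lia.
have c5 := coef_g132_2_5 n5.
split.
  (* The witness is the quotient by q^6; the part below degree 6 is then read off coefficient by
     coefficient. *)
  exists (drop_poly 6 (g132 n 2)); rewrite -{1}(poly_take_drop 6 (g132 n 2)).
  congr (_ + _); rewrite /take_poly poly_def !big_ord_recr big_ord0 /=.
  by rewrite c3 c4 c5 !coef_g132_2_lt3 // !scale0r !add0r.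
have c2 : 'C(n.-1, 2)%:Z *+ 2 = (n%:Z - 1) * (n%:Z - 2).
  case: n n5 {c3 c4 c5} => [|[|n]] // _ /=.
  have := sqr_bin2 n; rewrite binS bin1; lia.
(* The coefficient falls by 1 from q^3 to q^4 and rises by C(n - 2, 2) - 2 from q^4 to q^5, which is
   positive for n >= 5. The doubled binomial [c2] turns these comparisons into polynomial
   inequalities. *)
apply: (@valley_not_unimodal _ 3); rewrite ?c3 ?c4 ?c5; nia.
Qed.
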